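(* Let $M$ be an object of an abelian category $\mathcal{A}$. Then: (1) $M$ is strongly self-Baer if and only if $M$ is self-Baer and weak duo. (2) $M$ is dual strongly self-Baer if and only if $M$ is dual self-Baer and weak duo.
   Context: A direct summand $K$ of an object $X$ of an abelian category, with inclusion $k:K\to X$, is fully invariant if for every endomorphism $h:X\to X$ there is a morphism $\alpha:K\to K$ with $hk=k\alpha$ (i.e. $h(K)\subseteq K$). An object is weak duo if each of its direct summands is fully invariant. An object $M$ is self-Baer (respectively strongly self-Baer) if for every family $(f_i)_{i\in I}$ of endomorphisms of $M$, $\bigcap_{i\in I}{\rm Ker}(f_i)$ is a direct summand (respectively a fully invariant direct summand) of $M$. An object $M$ is dual self-Baer (respectively dual strongly self-Baer) if for every family $(f_i)_{i\in I}$ of endomorphisms of $M$, $\sum_{i\in I}{\rm Im}(f_i)$ is a direct summand (respectively a fully invariant direct summand) of $M$. *)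

(* Defs.v *)
From HB Require Import structures.
From mathcomp Require Import all_boot all_algebra.

Set Implicit Arguments.
Unset Strict Implicit.
Unset Printing Implicit Defensive.

Import GRing.Theory.
Local Open Scope ring_scope.

Declare Scope cat_scope.
Delimit Scope cat_scope with cat.

(* Preadditive categories, as categories enriched in abelian groups:          *)
(*   hom X Y == the abelian group of morphisms X -> Y                         *)
(*    g \o f == the composite, f first (cat_scope)                            *)
HB.mixin Record isPreadditive (C : Type) := {
  hom : C -> C -> zmodType;
  idm : forall X : C, hom X X;
  comp : forall X Y Z : C, hom Y Z -> hom X Y -> hom X Z;
  compA : forall (W X Y Z : C) (h : hom Y Z) (g : hom X Y) (f : hom W X),
    comp _ _ _ h (comp _ _ _ g f) = comp _ _ _ (comp _ _ _ h g) f;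
  comp1m : forall (X Y : C) (f : hom X Y), comp _ _ _ (idm Y) f = f;
  compm1 : forall (X Y : C) (f : hom X Y), comp _ _ _ f (idm X) = f;
  compDl : forall (X Y Z : C) (g g' : hom Y Z) (f : hom X Y),
    comp _ _ _ (g + g') f = comp _ _ _ g f + comp _ _ _ g' f;
  compDr : forall (X Y Z : C) (g : hom Y Z) (f f' : hom X Y),
    comp _ _ _ g (f + f') = comp _ _ _ g f + comp _ _ _ g f'
}.

#[short(type="preadditiveType")]
HB.structure Definition Preadditive := { C of isPreadditive C }.

Arguments hom {s} X Y : rename.
Arguments idm {s} X : rename.
Arguments comp {s X Y Z} g f : rename.
Arguments compA {s W X Y Z} h g f : rename.
Arguments comp1m {s X Y} f : rename.
Arguments compm1 {s X Y} f : rename.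
Arguments compDl {s X Y Z} g g' f : rename.
Arguments compDr {s X Y Z} g f f' : rename.

Notation "g \o f" := (comp g f) : cat_scope.
Local Open Scope cat_scope.

Section PreadditiveDefs.
Variable C : preadditiveType.
Implicit Types X Y Z : C.

Definition is_mono X Y (f : hom X Y) :=
  forall Z (u v : hom Z X), f \o u = f \o v -> u = v.

Definition is_epi X Y (f : hom X Y) :=
  forall Z (u v : hom Y Z), u \o f = v \o f -> u = v.

Definition is_zero_object Z :=
  forall X, (forall f : hom X Z, f = 0) /\ (forall f : hom Z X, f = 0).

Definition is_biproduct X Y S (i : hom X S) (j : hom Y S)
    (p : hom S X) (q : hom S Y) :=
  [/\ p \o i = idm X, q \o j = idm Y, p \o j = 0, q \o i = 0
    & (i \o p) + (j \o q) = idm S].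

Definition is_kernel X Y (f : hom X Y) K (k : hom K X) :=
  f \o k = 0 /\
  forall Z (g : hom Z X), f \o g = 0 -> exists! u : hom Z K, k \o u = g.

Definition is_cokernel X Y (f : hom X Y) Q (c : hom Y Q) :=
  c \o f = 0 /\
  forall Z (g : hom Y Z), g \o f = 0 -> exists! u : hom Q Z, u \o c = g.

Lemma kernel_mono X Y (f : hom X Y) K (k : hom K X) :
  is_kernel f k -> is_mono k.
Proof.
move=> [fk0 kP] Z u v kuv.
have fkv0 : f \o (k \o v) = 0.
  by rewrite compA fk0; apply: (addrI (0 \o v)); rewrite -compDl !addr0.
have [w [_ w_uniq]] := kP _ _ fkv0.
by rewrite -(w_uniq u kuv) -(w_uniq v erefl).
Qed.

End PreadditiveDefs.

(* Kernels and cokernels are chosen as part of the structure, so that the     *)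
(* subobjects Ker f and Im f below are operations; the choice is immaterial   *)
(* up to isomorphism.                                                         *)
HB.mixin Record isAbelian C of Preadditive C := {
  zero_object_ex : exists Z : C, is_zero_object Z;
  biproduct_ex : forall X Y : C,
    exists (S : C) (i : hom X S) (j : hom Y S) (p : hom S X) (q : hom S Y),
      is_biproduct i j p q;
  ker : forall X Y : C, hom X Y -> C;
  ker_in : forall (X Y : C) (f : hom X Y), hom (ker X Y f) X;
  ker_inP : forall (X Y : C) (f : hom X Y), is_kernel f (ker_in X Y f);
  coker : forall X Y : C, hom X Y -> C;
  coker_pr : forall (X Y : C) (f : hom X Y), hom Y (coker X Y f);
  coker_prP : forall (X Y : C) (f : hom X Y), is_cokernel f (coker_pr X Y f);
  mono_normal : forall (X Y : C) (f : hom X Y), is_mono f ->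
    exists (Z : C) (g : hom Y Z), is_kernel g f;
  epi_conormal : forall (X Y : C) (f : hom X Y), is_epi f ->
    exists (Z : C) (g : hom Z X), is_cokernel g f
}.

#[short(type="abelianCatType")]
HB.structure Definition AbelianCat := { C of Preadditive C & isAbelian C }.

Arguments ker {s X Y} f : rename.
Arguments ker_in {s X Y} f : rename.
Arguments ker_inP {s X Y} f : rename.
Arguments coker {s X Y} f : rename.
Arguments coker_pr {s X Y} f : rename.
Arguments coker_prP {s X Y} f : rename.
Arguments mono_normal {s X Y} f : rename.
Arguments epi_conormal {s X Y} f : rename.

(* A subobject is represented by a monomorphism; equality of subobjects is    *)
(* mutual sub_le, not Leibniz equality.                                       *)
Record subobject (C : preadditiveType) (X : C) := Subobject {
  sub_obj : C;
  sub_in : hom sub_obj X;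
  sub_inP : is_mono sub_in
}.

Section Subobjects.
Variables (C : preadditiveType) (X : C).
Implicit Types K L S : subobject X.

Definition sub_le K L :=
  exists u : hom (sub_obj K) (sub_obj L), sub_in K = sub_in L \o u.

(* In an arbitrary abelian category the intersection and the sum of an        *)
(* infinite family of subobjects need not exist, hence relations.             *)
Definition is_intersection (I : Type) (F : I -> subobject X) S :=
  (forall i, sub_le S (F i)) /\
  (forall L, (forall i, sub_le L (F i)) -> sub_le L S).

Definition is_sum (I : Type) (F : I -> subobject X) S :=
  (forall i, sub_le (F i) S) /\
  (forall L, (forall i, sub_le (F i) L) -> sub_le S L).

Definition direct_summand K :=
  exists (Y : C) (j : hom Y X) (p : hom X (sub_obj K)) (q : hom X Y),
    is_biproduct (sub_in K) j p q.

Definition fully_invariant K :=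
  forall h : hom X X, exists a : hom (sub_obj K) (sub_obj K),
    h \o sub_in K = sub_in K \o a.

End Subobjects.

Definition weak_duo (C : preadditiveType) (X : C) :=
  forall K : subobject X, direct_summand K -> fully_invariant K.

Section Baer.
Variable A : abelianCatType.

Definition Ker (X Y : A) (f : hom X Y) : subobject X :=
  Subobject (kernel_mono (ker_inP f)).

Definition Im (X Y : A) (f : hom X Y) : subobject Y := Ker (coker_pr f).

Definition self_Baer (M : A) :=
  forall (I : Type) (f : I -> hom M M),
    exists2 S : subobject M,
      is_intersection (fun i => Ker (f i)) S & direct_summand S.

Definition strongly_self_Baer (M : A) :=
  forall (I : Type) (f : I -> hom M M),
    exists2 S : subobject M,
      is_intersection (fun i => Ker (f i)) S
      & direct_summand S /\ fully_invariant S.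

Definition dual_self_Baer (M : A) :=
  forall (I : Type) (f : I -> hom M M),
    exists2 S : subobject M,
      is_sum (fun i => Im (f i)) S & direct_summand S.

Definition dual_strongly_self_Baer (M : A) :=
  forall (I : Type) (f : I -> hom M M),
    exists2 S : subobject M,
      is_sum (fun i => Im (f i)) S
      & direct_summand S /\ fully_invariant S.

End Baer.

(* Main.v *)
From HB Require Import structures.
From mathcomp Require Import all_boot all_algebra.
Require Import Defs.

(* Only "strong implies weak duo" has content.  A direct summand [K], with    *)
(* inclusion [k], projection [p] and complementary maps [j], [q], is both the *)
(* kernel of the endomorphism [j q] and the image of the idempotent [k p].    *)
(* The strong Baer properties, applied to a one-element family, make such     *)
(* kernels and images fully invariant.                                        *)

Set Implicit Arguments.
Unset Strict Implicit.
Unset Printing Implicit Defensive.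

Import GRing.Theory.
Local Open Scope ring_scope.
Local Open Scope cat_scope.

(** Under weak duo, the summand provided by a Baer property is automatically fully invariant;
    forgetting invariance is trivial. In the remaining direction, the intersection or sum of a
    one-element family is its member only up to mutual [sub_le], so [fully_invariant_equiv] carries
    invariance over to the summand that [direct_summand_Ker] or [direct_summand_Im] presents as a
    kernel or image. *)

Section Preadditive.
Variable C : preadditiveType.

Lemma comp0m (X Y Z : C) (f : hom X Y) : (0 : hom Y Z) \o f = 0.
Proof. by apply: (addrI (0 \o f)); rewrite -compDl !addr0. Qed.

Lemma compm0 (X Y Z : C) (g : hom Y Z) : g \o (0 : hom X Y) = 0.
Proof. by apply: (addrI (g \o 0)); rewrite -compDr !addr0. Qed.

Lemma sub_le_trans (X : C) (K L N : subobject X) :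
  sub_le K L -> sub_le L N -> sub_le K N.
Proof. by move=> [u Ku] [v Lv]; exists (v \o u); rewrite compA -Lv. Qed.

Lemma fully_invariant_equiv (X : C) (K L : subobject X) :
  sub_le K L -> sub_le L K -> fully_invariant K -> fully_invariant L.
Proof.
move=> [v Kv] [u Lu] Kinv h; have [a ha] := Kinv h.
by exists (v \o (a \o u)); rewrite {1}Lu compA ha -compA Kv -compA.
Qed.

(** Composing [i p + j q = 1] with [g] leaves only the [i] component. This puts the kernel or image
    below the summand. *)
Lemma biproduct_factor (X Y S Z : C) (i : hom X S) (j : hom Y S)
    (p : hom S X) (q : hom S Y) (g : hom Z S) :
  is_biproduct i j p q -> q \o g = 0 -> g = i \o (p \o g).
Proof.
move=> [_ _ _ _ sum1] qg0.
by rewrite -[LHS]comp1m -sum1 compDl -!compA qg0 compm0 addr0.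
Qed.

End Preadditive.

Section Abelian.
Variable A : abelianCatType.

Lemma sub_le_Ker (X Y : A) (f : hom X Y) (K : subobject X) :
  f \o sub_in K = 0 -> sub_le K (Ker f).
Proof.
move=> fK0; have [u [Ku _]] := (ker_inP f).2 _ _ fK0.
by exists u; rewrite /= Ku.
Qed.

Lemma direct_summand_Ker (M : A) (K : subobject M) : direct_summand K ->
  exists f : hom M M, sub_le K (Ker f) /\ sub_le (Ker f) K.
Proof.
move=> [Y [j [p [q bip]]]]; have [_ qj1 _ qk0 _] := bip.
exists (j \o q); split; first by apply: sub_le_Ker; rewrite -compA qk0 compm0.
(* Since [q j = 1], whatever [j q] kills is already killed by [q]. *)
exists (p \o ker_in (j \o q)); apply: (biproduct_factor bip).
have [jqx0 _] := ker_inP (j \o q).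
by rewrite -[LHS]comp1m -qj1 -compA (compA j) jqx0 compm0.
Qed.

Lemma direct_summand_Im (M : A) (K : subobject M) : direct_summand K ->
  exists f : hom M M, sub_le K (Im f) /\ sub_le (Im f) K.
Proof.
move=> [Y [j [p [q bip]]]]; have [pk1 _ _ qk0 _] := bip.
pose e := sub_in K \o p; exists e.
have [ce0 c_univ] := coker_prP e; split.
  (* With [k = sub_in K], [p k = 1] gives [k = e k], so the cokernel of [e] kills [k]. *)
  apply: sub_le_Ker.
  by rewrite -[sub_in K]compm1 -pk1 (compA (sub_in K)) compA ce0 comp0m.
(* As [q] kills [e], it factors through the cokernel of [e], and so vanishes on [Im e]. *)
have qe0 : q \o e = 0 by rewrite compA qk0 comp0m.
have [u [uc _]] := c_univ _ _ qe0.
exists (p \o ker_in (coker_pr e)); apply: (biproduct_factor bip).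
have [cx0 _] := ker_inP (coker_pr e).
by rewrite -uc -compA cx0 compm0.
Qed.

Lemma strongly_self_Baer_weak_duo (M : A) : strongly_self_Baer M -> weak_duo M.
Proof.
move=> sB K /direct_summand_Ker[f [leKf lefK]].
have [S [leSf glbS] [_ Sinv]] := sB unit (fun=> f).
apply: fully_invariant_equiv Sinv; first exact: sub_le_trans (leSf tt) lefK.
exact: glbS.
Qed.

Lemma dual_strongly_self_Baer_weak_duo (M : A) :
  dual_strongly_self_Baer M -> weak_duo M.
Proof.
move=> sB K /direct_summand_Im[f [leKf lefK]].
have [S [lefS lubS] [_ Sinv]] := sB unit (fun=> f).
apply: fully_invariant_equiv Sinv; first exact: lubS.
exact: sub_le_trans leKf (lefS tt).
Qed.

End Abelian.

Theorem corollary5p5 (A : abelianCatType) (M : A) :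
  (strongly_self_Baer M <-> self_Baer M /\ weak_duo M) /\
  (dual_strongly_self_Baer M <-> dual_self_Baer M /\ weak_duo M).
Proof.
split; split.
- move=> sB; split; last exact: strongly_self_Baer_weak_duo.
  by move=> I f; have [S fS [Ssum _]] := sB I f; exists S.
- move=> [B wd] I f; have [S fS Ssum] := B I f.
  by exists S => //; split; last exact: wd.
- move=> sB; split; last exact: dual_strongly_self_Baer_weak_duo.
  by move=> I f; have [S fS [Ssum _]] := sB I f; exists S.
- move=> [B wd] I f; have [S fS Ssum] := B I f.
  by exists S => //; split; last exact: wd.
Qed.
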